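(* For $n\in\mathbb{N}$ write $n=2^j m$ with $j\in\mathbb{N}\cup\{0\}$ and $m$ odd. Then $$\frac1n\sum_{k=1}^n c_n(k^2-1)=\begin{cases} c_j, & \text{if } j\in\{0,2,3\} \text{ and } m \text{ is squarefree},\\ 0,&\text{otherwise},\end{cases}$$ where $c_0=c_2=1$ and $c_3=2$ (in particular the value is nonzero in the first case).
   Context: For $n\in\mathbb{N}$ and $k\in\mathbb{Z}$, $c_n(k)=\sum_{1\le j\le n,\ \gcd(j,n)=1}\exp(2\pi i jk/n)$ is the Ramanujan sum. The constants $c_0,c_2,c_3$ are just numbers, not Ramanujan sums. *)

(* Defs.v *)
From HB Require Import structures.
From mathcomp Require Import all_boot all_order all_algebra.
From mathcomp Require Import all_classical all_reals all_analysis.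
From mathcomp Require Export complex.
Set Implicit Arguments.
Unset Strict Implicit.
Unset Printing Implicit Defensive.
Import Order.TTheory GRing.Theory Num.Theory.

Local Open Scope ring_scope.
Local Open Scope complex_scope.

Definition cexp (R : realType) (z : R[i]) : R[i] :=
  let: x +i* y := z in (expR x * cos y) +i* (expR x * sin y).

Definition ramanujan_sum (R : realType) (n : nat) (k : int) : R[i] :=
  \sum_(1 <= j < n.+1 | coprime j n)
    cexp ((2 * pi * j%:R * k%:~R / n%:R : R) *i).

Definition squarefree (m : nat) : Prop :=
  forall d : nat, (d ^ 2 %| m)%N -> d = 1%N.

(* Only the values at 0, 2 and 3 are meaningful. *)
Definition const_c (j : nat) : nat :=
  (match j with 0 => 1 | 2 => 1 | 3 => 2 | _ => 0 end)%N.

(* Main.v *)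
Require Import Defs.
From mathcomp Require Import all_boot all_order all_algebra.
From mathcomp Require Import all_classical all_reals all_analysis.
From mathcomp Require Import zify ring lra.
Import Order.TTheory GRing.Theory Num.Theory.
Local Open Scope ring_scope.
Local Open Scope complex_scope.

(** Write S(n) for the normalised sum.  Grouping the n-th roots of unity by
    their order gives sum_{d | n} c_d(a) = n if n divides a and 0 otherwise;
    since c_d(k^2 - 1) is d-periodic in k, averaging over k yields
    sum_{d | n} S(d) = N(n), the number of square roots of 1 modulo n.  As N is
    multiplicative with N(p^e) = 2 for odd p and N(2^e) = 1, 1, 2, 4, 4, ...,
    the function S, being the Moebius inverse of N, is the multiplicative
    function whose values at p^e (e >= 1) are 1, 0, 0, ... for odd p and
    0, 1, 2, 0, 0, ... for p = 2. *)

Section Arithmetic.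
Local Open Scope nat_scope.

(** * Multiplicative functions and divisor sums *)

Definition multiplicative (f : nat -> nat) : Prop :=
  f 1 = 1 /\
  forall a b, 0 < a -> 0 < b -> coprime a b -> f (a * b) = f a * f b.

(** Strong induction: splitting off the full power of the least prime factor of [n] leaves a smaller
    cofactor prime to it. *)
Lemma eq_multiplicative (f g : nat -> nat) :
    multiplicative f -> multiplicative g ->
    (forall p e, prime p -> 0 < e -> f (p ^ e) = g (p ^ e)) ->
  forall n, 0 < n -> f n = g n.
Proof.
move=> [f1 fM] [g1 gM] fg; elim/ltn_ind=> n IHn n_gt0.
have [->|n_neq1] := eqVneq n 1; first by rewrite f1 g1.
have n_gt1 : 1 < n by lia.
have p_pr := pdiv_prime n_gt1.
set p := pdiv n in p_pr *.
have e_gt0 : 0 < logn p n by rewrite logn_gt0 pi_pdiv.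
have q_gt1 : 1 < p ^ logn p n by rewrite -(exp1n (logn p n)) ltn_exp2r ?prime_gt1.
have defn := partnC p n_gt0; have co := coprime_partC p n n.
have r_gt0 : 0 < n`_p^' by rewrite part_gt0.
rewrite p_part in defn co; rewrite -defn fM ?gM //; try lia.
by rewrite fg // IHn //; nia.
Qed.

(** The inverse of multiplication (x, y) -> x y is d -> (gcd(d, a), gcd(d, b)). *)
Lemma divisorsM_perm (a b : nat) : 0 < a -> 0 < b -> coprime a b ->
  perm_eq (divisors (a * b)) [seq x * y | x <- divisors a, y <- divisors b].
Proof.
move=> a_gt0 b_gt0 co; have ab_gt0 : 0 < a * b by rewrite muln_gt0 a_gt0.
have gcdl x y : x %| a -> y %| b -> gcdn (x * y) a = x.
  move=> xa yb; rewrite gcdnC Gauss_gcdl; first exact/gcdn_idPr.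
  exact: coprime_dvdr yb co.
have gcdr x y : x %| a -> y %| b -> gcdn (x * y) b = y.
  move=> xa yb; rewrite gcdnC Gauss_gcdr; first exact/gcdn_idPr.
  by rewrite coprime_sym; apply: coprime_dvdl xa co.
apply: uniq_perm; rewrite ?divisors_uniq //.
  apply: allpairs_uniq; rewrite ?divisors_uniq //.
  move=> _ _ /allpairsP[[x y] [/= xa yb ->]] /allpairsP[[u v] [/= ua vb ->]] /=.
  rewrite -!dvdn_divisors // in xa yb ua vb => E.
  by congr pair; [rewrite -(gcdl x y) // E gcdl | rewrite -(gcdr x y) // E gcdr].
move=> d; rewrite -dvdn_divisors //; apply/idP/allpairsP => [dab|[[x y] /=]].
  exists (gcdn d a, gcdn d b) => /=; rewrite -!dvdn_divisors // !dvdn_gcdr.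
  split=> //; rewrite muln_gcdr !muln_gcdl.
  (* The expanded product is the gcd of d d, a d, d b and a b, all multiples of d. Conversely,
     gcd(d, a) and gcd(d, b) are coprime divisors of d. *)
  apply/eqP; rewrite eqn_dvd; apply/andP; split.
    rewrite !dvdn_gcd; apply/andP; split; apply/andP; split.
    - exact: dvdn_mulr.
    - exact: dvdn_mull.
    - exact: dvdn_mulr.
    - exact: dab.
  rewrite -muln_gcdl -muln_gcdl -muln_gcdr Gauss_dvd ?dvdn_gcdl //.
  by apply: coprime_dvdl (dvdn_gcdr d a) _; apply: coprime_dvdr (dvdn_gcdr d b) _.
by rewrite -!dvdn_divisors // => -[xa yb ->]; apply: dvdn_mul.
Qed.

Lemma divisors_pfactor_perm (p e : nat) : prime p ->
  perm_eq (divisors (p ^ e)) [seq p ^ i | i <- iota 0 e.+1].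
Proof.
move=> p_pr; have p_gt1 := prime_gt1 p_pr.
apply: uniq_perm; rewrite ?divisors_uniq //.
  rewrite map_inj_in_uniq ?iota_uniq // => x y _ _ /eqP.
  by rewrite eqn_exp2l // => /eqP.
move=> d; rewrite -dvdn_divisors ?expn_gt0 ?prime_gt0 //.
apply/(dvdn_pfactor d e p_pr)/mapP => -[k]; rewrite ?mem_iota => ke ->;
  by exists k => //; rewrite ?mem_iota; lia.
Qed.

Lemma multiplicative_divisor_sum (f : nat -> nat) : multiplicative f ->
  multiplicative (fun n => \sum_(d <- divisors n) f d).
Proof.
move=> [f1 fM]; split=> [|a b a_gt0 b_gt0 co]; first by rewrite big_seq1.
rewrite (perm_big _ (divisorsM_perm _ _ a_gt0 b_gt0 co)) big_allpairs_dep /=.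
rewrite big_distrl /= !big_seq; apply: eq_bigr => x.
rewrite big_distrr /= -dvdn_divisors // !big_seq => xa; apply: eq_bigr => y.
rewrite -dvdn_divisors // => yb; apply: fM.
- exact: dvdn_gt0 xa.
- exact: dvdn_gt0 yb.
- by apply: coprime_dvdl xa _; apply: coprime_dvdr yb _.
Qed.

(** * Counting the square roots of 1 modulo n *)

Definition unit_roots (n : nat) : seq nat :=
  [seq k <- iota 0 n | k ^ 2 == 1 %[mod n]].

Lemma mem_unit_roots (n k : nat) :
  (k \in unit_roots n) = (k ^ 2 == 1 %[mod n]) && (k < n).
Proof. by rewrite mem_filter mem_iota. Qed.

(** The Chinese remainder theorem pairs roots modulo [a] and modulo [b] with roots modulo [a * b];
    the outer [%% (a * b)] brings the lifted value into the range listed by [unit_roots]. *)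
Lemma multiplicative_size_unit_roots :
  multiplicative (fun n => size (unit_roots n)).
Proof.
split=> // a b a_gt0 b_gt0 co; have ab_gt0 : 0 < a * b by rewrite muln_gt0 a_gt0.
rewrite -(size_allpairs (fun x y => chinese a b x y %% (a * b))).
have modl x y : (chinese a b x y %% (a * b)) %% a = x %% a.
  by rewrite modn_dvdm ?dvdn_mulr // chinese_modl.
have modr x y : (chinese a b x y %% (a * b)) %% b = y %% b.
  by rewrite modn_dvdm ?dvdn_mull // chinese_modr.
apply/perm_size/uniq_perm; first by rewrite filter_uniq ?iota_uniq.
  apply: allpairs_uniq; rewrite ?filter_uniq ?iota_uniq //.
  move=> _ _ /allpairsP[[x y] [/= xa yb ->]] /allpairsP[[u v] [/= ua vb ->]] /=.
  move: xa yb ua vb; rewrite !mem_unit_roots.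
  move=> /andP[_ xa] /andP[_ yb] /andP[_ ua] /andP[_ vb] E.
  congr pair.
    by rewrite -(modn_small xa) -(modl x y) E modl modn_small.
  by rewrite -(modn_small yb) -(modr x y) E modr modn_small.
move=> k; rewrite mem_unit_roots chinese_remainder //.
apply/idP/allpairsP => [/andP[/andP[ka kb] klt]|[[x y] /= [+ + ->]]].
  exists (k %% a, k %% b); rewrite /= !mem_unit_roots !ltn_pmod // !modnXm ka kb.
  by split=> //; rewrite -(chinese_mod co) modn_small.
rewrite !mem_unit_roots ltn_pmod // => /andP[xa _] /andP[yb _].
by rewrite -modnXm modl modnXm xa -modnXm modr modnXm yb.
Qed.

(** Positivity of [k] guards the truncated subtraction: at k = 0 the right-hand product would be 0,
    divisible by every [n]. *)
Lemma unit_roots_dvd (n k : nat) : 0 < k ->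
  (k ^ 2 == 1 %[mod n]) = (n %| (k - 1) * (k + 1)).
Proof.
move=> k_gt0; rewrite eqn_mod_dvd ?expn_gt0 ?k_gt0 //.
by rewrite -{2}(exp1n 2) subn_sqr.
Qed.

(** An odd prime cannot divide both k - 1 and k + 1, which differ by 2, so the whole power p^e
    divides one of them, leaving only k = 1 and k = p^e - 1. *)
Lemma size_unit_roots_odd (p e : nat) : prime p -> odd p -> 0 < e ->
  size (unit_roots (p ^ e)) = 2.
Proof.
move=> p_pr p_odd e_gt0; have p_gt2 := odd_prime_gt2 p_odd p_pr.
set q := p ^ e.
have pq : p %| q by rewrite /q -(prednK e_gt0) expnS dvdn_mulr.
have q_gt2 : 2 < q.
  by apply: leq_trans p_gt2 _; apply: dvdn_leq pq; rewrite expn_gt0; lia.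
suff /perm_size-> : perm_eq (unit_roots q) [:: 1; q - 1] by [].
apply: uniq_perm; rewrite ?filter_uniq ?iota_uniq //=; first by rewrite inE; lia.
move=> k; rewrite mem_unit_roots !inE; case: (posnP k) => [->|k_gt0].
  by rewrite exp0n // mod0n modn_small; lia.
rewrite unit_roots_dvd //.
have [pk|pk] := boolP (p %| k - 1); last first.
  rewrite Gauss_dvdr; last by rewrite coprime_pexpl // prime_coprime.
  apply/andP/orP => [[qk klt]|[/eqP E|/eqP E]]; [|by rewrite E dvdn0 in pk|].
    right; have := dvdn_leq _ qk; lia.
  by rewrite E subnK ?dvdnn; [split; lia | lia].
rewrite mulnC Gauss_dvdr; last first.
  rewrite coprime_pexpl // prime_coprime //; apply/negP => pk2.
  have : p %| (k + 1) - (k - 1) by rewrite dvdn_sub.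
  by move/dvdn_leq; lia.
apply/andP/orP => [[qk klt]|[/eqP E|/eqP E]].
- left; have [k1|k1] := posnP (k - 1); first lia.
  by have := dvdn_leq k1 qk; lia.
- by rewrite E; split; [rewrite dvdn0|lia].
- have : p %| q - (k - 1) by rewrite dvdn_sub.
  by move/dvdn_leq; lia.
Qed.

(* With k = 2l+1 the condition 2^(e+3) | k^2 - 1 says 2^(e+1) | l(l+1). *)
Lemma size_unit_roots_pow2 (e : nat) : size (unit_roots (2 ^ e.+3)) = 4.
Proof.
set q := 2 ^ e.+1; have -> : 2 ^ e.+3 = 4 * q by rewrite /q !expnS; lia.
have q2 : 2 %| q by rewrite /q expnS dvdn_mulr.
have q_gt0 : 0 < q by rewrite expn_gt0.
have q_gt1 : 1 < q by apply: dvdn_leq.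
suff /perm_size-> : perm_eq (unit_roots (4 * q))
  [:: 1; 2 * q - 1; 2 * q + 1; 4 * q - 1] by [].
apply: uniq_perm; rewrite ?filter_uniq ?iota_uniq //=.
  by rewrite !inE; lia.
move=> k; rewrite mem_unit_roots !inE; have [k_odd|k_even] := boolP (odd k); last first.
  have -> : (k ^ 2 == 1 %[mod 4 * q]) = false.
    apply/negP => /eqP/(congr1 (fun x => x %% 2)).
    rewrite !modn_dvdm ?dvdn_mulr // modn2 oddX /=; lia.
  by move: q2; lia.
have [l kE] : exists l, k = 2 * l + 1 by exists k./2; lia.
rewrite unit_roots_dvd; last lia.
have -> : (k - 1) * (k + 1) = 4 * (l * (l + 1)) by rewrite kE; nia.
rewrite dvdn_pmul2l //.
have dvd_small x : x <= 2 * q -> (q %| x) = [|| x == 0, x == q | x == 2 * q].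
  move=> xq; apply/idP/idP => [/dvdnP[c xE]|]; last first.
    by case/or3P => /eqP->; rewrite ?dvdn0 ?dvdnn ?dvdn_mull.
  have c_le2 : c <= 2 by rewrite xE leq_pmul2r in xq.
  by rewrite xE; case: c c_le2 {xE} => [|[|[|c]]] //; lia.
have [klt|kge] := ltnP k (4 * q); last by lia.
(* The odd one of l, l + 1 is prime to q, so q divides the even one, which is at most 2q. Even l
   gives l = 0 or q, that is k = 1 or 2q + 1; odd l gives l + 1 = q or 2q, that is k = 2q - 1 or 4q
   - 1. *)
rewrite andbT; have [l2|l2] := boolP (2 %| l).
  rewrite mulnC Gauss_dvdr; last first.
    by rewrite coprime_pexpl // prime_coprime //; lia.
  by rewrite dvd_small; [move: q2; lia | lia].
rewrite Gauss_dvdr; last by rewrite coprime_pexpl // prime_coprime.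
by rewrite dvd_small; [move: q2; lia | lia].
Qed.

(** * The multiplicative function with the predicted values *)

Definition local_factor (p e : nat) : nat :=
  if p == 2 then const_c e else (e <= 1)%N.

Definition mean_value (n : nat) : nat :=
  \prod_(p <- primes n) local_factor p (logn p n).

Lemma multiplicative_mean_value : multiplicative mean_value.
Proof.
split=> [|a b a_gt0 b_gt0 co]; first by rewrite /mean_value big_nil.
have disj p : p \in primes a -> p \in primes b -> False.
  rewrite !mem_primes => /and3P[p_pr _ pa] /and3P[_ _ pb].
  have : p %| gcdn a b by rewrite dvdn_gcd pa.
  by rewrite (eqP co) dvdn1 => /eqP p1; rewrite p1 in p_pr.
rewrite /mean_value (perm_big (primes a ++ primes b)); last first.
  apply: uniq_perm; rewrite ?primes_uniq //.
    rewrite cat_uniq !primes_uniq /= andbT; apply/hasPn => p pb /=.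
    by apply/negP => pa; apply: disj pa pb.
  by move=> p; rewrite primesM // mem_cat.
have log0 p n : p \notin primes n -> logn p n = 0.
  by rewrite -logn_gt0 lt0n negbK => /eqP.
rewrite big_cat /=; congr muln; rewrite !big_seq.
  apply: eq_bigr => p pa; rewrite lognM // (log0 p b) ?addn0 //.
  by apply/negP; apply: disj.
apply: eq_bigr => p pb; rewrite lognM // (log0 p a) ?addn0 //.
by apply/negP => pa; apply: disj pa pb.
Qed.

Lemma mean_value_pfactor (p e : nat) : prime p ->
  mean_value (p ^ e) = local_factor p e.
Proof.
move=> p_pr; rewrite /mean_value; case: (posnP e) => [->|e_gt0].
  by rewrite expn0 big_nil /local_factor; case: eqP.
by rewrite primesX // primes_prime // big_seq1 pfactorK.
Qed.

(** Both sides are multiplicative, so it suffices to add up the local factors at the divisors of a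
    prime power. *)
Lemma sum_mean_value (n : nat) : 0 < n ->
  \sum_(d <- divisors n) mean_value d = size (unit_roots n).
Proof.
move: n; apply: eq_multiplicative.
- exact: multiplicative_divisor_sum multiplicative_mean_value.
- exact: multiplicative_size_unit_roots.
move=> p e p_pr e_gt0.
rewrite (perm_big _ (divisors_pfactor_perm _ e p_pr)) big_map.
under eq_bigr do rewrite mean_value_pfactor //.
have [p2|p_odd] := even_prime p_pr.
  (* The partial sums of 1, 0, 1, 2, 0, 0, ... from exponent 1 on are 1, 2, 4, 4, ...; the first two
     root counts are found by computation. *)
  rewrite p2 /local_factor eqxx; case: e e_gt0 => [//|[|[|e]]] _.
  - by rewrite !big_cons big_nil.
  - by rewrite !big_cons big_nil.
  rewrite size_unit_roots_pow2 /= !big_cons big1_seq ?addn0 // => i /=.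
  by rewrite mem_iota; case: i => [|[|[|[|i]]]].
rewrite size_unit_roots_odd // /local_factor.
have -> : (p == 2) = false by case: eqP p_odd => // ->.
case: e e_gt0 => [//|e] _; rewrite /= !big_cons big1_seq // => i /=.
by rewrite mem_iota; case: i => [|[|i]].
Qed.

Lemma mean_value_odd (m : nat) : odd m ->
  (squarefree m -> mean_value m = 1) /\ (~ squarefree m -> mean_value m = 0).
Proof.
move=> m_odd; have m_gt0 : 0 < m by case: m m_odd.
have lf p : p \in primes m -> local_factor p (logn p m) = (logn p m <= 1).
  rewrite mem_primes => /and3P[_ _ pm]; rewrite /local_factor.
  by case: eqP pm => // ->; rewrite dvdn2 m_odd.
split=> [sqf|nsqf].
  rewrite /mean_value big1_seq // => p /= pm; rewrite lf //.
  rewrite leqNgt; have [p2|//] := boolP (1 < logn p m).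
  have pp : prime p by move: pm; rewrite mem_primes => /and3P[].
  by have p1 := sqf p; rewrite pfactor_dvdn // in p1; rewrite (p1 p2) in pp.
(* If d^2 divides m with d > 1, the least prime factor of d has exponent at least 2 in m and
   contributes a zero factor. *)
apply/eqP; apply/contraT => nz; case: nsqf => d d2m.
have d_gt0 : 0 < d by case: d d2m => [|//]; rewrite dvd0n; lia.
apply/eqP; apply/contraT => d1.
have d_gt1 : 1 < d by lia.
have p_pr := pdiv_prime d_gt1; have pd := pdiv_dvd d.
have pm : pdiv d ^ 2 %| m by apply: dvdn_trans d2m; rewrite dvdn_exp2r.
have pin : pdiv d \in primes m.
  by rewrite mem_primes p_pr m_gt0 (dvdn_trans _ pm) // dvdn_exp.
rewrite /mean_value (big_rem _ pin) /= lf // leqNgt in nz.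
by rewrite pfactor_dvdn // in pm; rewrite pm mul0n eqxx in nz.
Qed.
End Arithmetic.

(** * The additive character exp(2 pi i t) and its orthogonality *)

Section AdditiveCharacter.
Variable R : realType.

Definition circle_exp (t : R) : R[i] := cexp ((2 * pi * t) *i).

Lemma circle_expE (t : R) :
  circle_exp t = cos (2 * pi * t) +i* sin (2 * pi * t).
Proof. by rewrite /circle_exp /= expR0 !mul1r. Qed.

Lemma circle_expD (s t : R) : circle_exp (s + t) = circle_exp s * circle_exp t.
Proof.
rewrite !circle_expE mulrDr cosD sinD.
by apply/eqP; rewrite eq_complex /= eqxx addrC eqxx.
Qed.

Lemma circle_exp0 : circle_exp 0 = 1.
Proof. by rewrite circle_expE mulr0 cos0 sin0. Qed.

Lemma circle_exp1 : circle_exp 1 = 1.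
Proof. by rewrite circle_expE mulr1 mulr_natl cos2pi sin2pi. Qed.

Lemma circle_exp_natM (n : nat) (t : R) :
  circle_exp (n%:R * t) = circle_exp t ^+ n.
Proof.
elim: n => [|n IHn]; first by rewrite mul0r circle_exp0.
by rewrite -natr1 mulrDl mul1r circle_expD IHn exprSr.
Qed.

Lemma circle_exp_nat (n : nat) : circle_exp n%:R = 1.
Proof. by rewrite -[n%:R]mulr1 circle_exp_natM circle_exp1 expr1n. Qed.

Lemma circle_exp_int (z : int) : circle_exp z%:~R = 1.
Proof.
case: z => n; first exact: circle_exp_nat.
rewrite NegzE -[LHS]mulr1 -{1}(circle_exp_nat n.+1) -circle_expD.
by rewrite mulrNz addNr circle_exp0.
Qed.

(** The real part is 1 - 2 sin(pi t)^2, and sin is positive on the open interval from 0 to pi. *)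
Lemma circle_exp_neq1 (t : R) : 0 < t < 1 -> circle_exp t != 1.
Proof.
move=> /andP[t_gt0 t_lt1]; rewrite circle_expE eq_complex negb_and; apply/orP; left.
have s_gt0 : 0 < sin (pi * t).
  by apply: sin_gt0_pi; rewrite mulr_gt0 ?pi_gt0 //= gtr_pMr ?pi_gt0.
rewrite -mulrA mulr_natl cos_mulr2n cos2sin2 /=.
have : 0 < sin (pi * t) ^+ 2 by rewrite exprn_gt0.
by move=> s2; apply/negP => /eqP; lra.
Qed.

(** This is a geometric sum whose ratio z satisfies z^n = 1: either z = 1, or the sum is annihilated
    by z - 1 and so vanishes. *)
Lemma sum_circle_exp (n : nat) (a : int) : (0 < n)%N ->
  \sum_(1 <= i < n.+1) circle_exp (i%:R * (a%:~R / n%:R)) =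
  if (n %| a)%Z then n%:R else 0.
Proof.
move=> n_gt0; have n_neq0 : n%:R != 0 :> R by rewrite pnatr_eq0; lia.
set z := circle_exp (a%:~R / n%:R).
have zn : z ^+ n = 1.
  by rewrite -circle_exp_natM mulrC divfK // circle_exp_int.
have -> : \sum_(1 <= i < n.+1) circle_exp (i%:R * (a%:~R / n%:R)) =
    z * \sum_(i < n) z ^+ i.
  rewrite big_add1 /= big_mkord mulr_sumr; apply: eq_bigr => i _.
  by rewrite circle_exp_natM exprS.
have [/dvdzP[q aE]|nda] := boolP (n %| a)%Z.
  have -> : z = 1.
    by rewrite /z aE intrM mulfK ?circle_exp_int.
  by rewrite mul1r (eq_bigr (fun=> 1)) ?sumr_const ?card_ord // => i _; rewrite expr1n.
suff z_neq1 : z != 1.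
  have /eqP := subrX1 z n; rewrite zn subrr eq_sym mulf_eq0 subr_eq0 (negPf z_neq1).
  by move=> /eqP ->; rewrite mulr0.
(* Dropping the integer part of a / n leaves (a mod n) / n, strictly between 0 and 1. *)
rewrite /z (divz_eq a n) intrD mulrDl intrM mulfK // circle_expD circle_exp_int mul1r.
have n_posz : n%:Z != 0 by lia.
apply: circle_exp_neq1; rewrite divr_gt0 ?ltr0n ?ltr0z //=; last first.
  by rewrite lt_def modz_ge0 // andbT; apply: contra nda => /eqP/dvdz_mod0P.
rewrite ltr_pdivrMr ?ltr0n // mul1r -[n%:R]/(n%:Z%:~R) ltr_int.
by rewrite ltz_pmod.
Qed.

End AdditiveCharacter.

(** * Periodic sums, sums over reduced fractions, and Moebius uniqueness *)

Lemma sum_periodic (V : nmodType) (F : nat -> V) (d q : nat) :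
    (forall k, F (k + d)%N = F k) ->
  \sum_(1 <= k < (d * q).+1) F k = (\sum_(1 <= k < d.+1) F k) *+ q.
Proof.
move=> perF; elim: q => [|q IHq]; first by rewrite muln0 big_geq.
rewrite (big_cat_nat (n := (d * q).+1)) //=; last by nia.
rewrite IHq mulrSr; congr (_ + _).
have -> : (d * q).+1 = (1 + d * q)%N by lia.
rewrite big_addn; have -> : ((d * q.+1).+1 - d * q)%N = d.+1 by nia.
apply: eq_bigr => k _; elim: q {IHq} => [|q IHq]; first by rewrite muln0 addn0.
by rewrite mulnS addnCA addnC perF.
Qed.

(** The denominator of i / n in lowest terms is n / gcd(i, n); it equals d exactly when i / n = j /
    d with j prime to d. *)
Lemma divisors_frac_perm (n d : nat) : (0 < n)%N -> (d %| n)%N ->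
  perm_eq [seq i <- index_iota 1 n.+1 | n %/ gcdn i n == d]%N
    [seq (j * (n %/ d))%N | j <- index_iota 1 d.+1 & coprime j d].
Proof.
move=> n_gt0 /dvdnP[q nE]; rewrite nE in n_gt0 *.
have d_gt0 : (0 < d)%N by nia.
have q_gt0 : (0 < q)%N by nia.
rewrite mulnK //; apply: uniq_perm; rewrite ?filter_uniq ?iota_uniq //.
  by rewrite map_inj_uniq ?filter_uniq ?iota_uniq // => x y; nia.
move=> i; rewrite mem_filter mem_index_iota; apply/idP/mapP => [/andP[]|[j]].
  move=> /eqP iE /andP[i_gt0 i_le].
  have g_gt0 : (0 < gcdn i (q * d))%N by rewrite gcdn_gt0 i_gt0.
  have gE : gcdn i (q * d) = q.
    have := divnK (dvdn_gcdr i (q * d)); rewrite iE => E; nia.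
  have /dvdnP[j jE] : (q %| i)%N by rewrite -gE dvdn_gcdl.
  exists j => //; rewrite mem_filter mem_index_iota; apply/andP; split; last by nia.
  have : (gcdn (q * j) (q * d) = q)%N by rewrite (mulnC q j) -jE.
  by rewrite -muln_gcdr /coprime; nia.
rewrite mem_filter mem_index_iota => /andP[co /andP[j_gt0 j_le]] ->.
rewrite (mulnC j) -muln_gcdr (eqP co) muln1 mulKn // eqxx /=; nia.
Qed.

(** The fractions i / n are sorted by their reduced denominator d, each falling into exactly one
    class. *)
Lemma sum_frac (V : nmodType) (F : nat -> V) (n : nat) : (0 < n)%N ->
  \sum_(1 <= i < n.+1) F i =
  \sum_(d <- divisors n) \sum_(1 <= j < d.+1 | coprime j d) F (j * (n %/ d))%N.
Proof.
move=> n_gt0.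
transitivity (\sum_(1 <= i < n.+1) \sum_(d <- divisors n)
   if (n %/ gcdn i n == d)%N then F i else 0).
  apply: eq_bigr => i _.
  rewrite (bigD1_seq (n %/ gcdn i n)%N) ?divisors_uniq //=; last first.
    by rewrite -dvdn_divisors // dvdn_div ?dvdn_gcdr.
  rewrite eqxx big1 ?addr0 // => d; rewrite eq_sym => /negPf-> //.
rewrite exchange_big /= !big_seq; apply: eq_bigr => d.
rewrite -dvdn_divisors // => dn.
rewrite -big_mkcond -big_filter (perm_big _ (divisors_frac_perm _ _ n_gt0 dn)) /=.
by rewrite big_map big_filter.
Qed.

(** Uniqueness in Moebius inversion, without the Moebius function: by strong induction the terms at
    proper divisors cancel. *)
Lemma eq_divisor_sums (V : zmodType) (f g : nat -> V) :
    (forall n, (0 < n)%N ->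
       \sum_(d <- divisors n) f d = \sum_(d <- divisors n) g d) ->
  forall n, (0 < n)%N -> f n = g n.
Proof.
move=> fg; elim/ltn_ind => n IHn n_gt0; have := fg n n_gt0.
have nn : n \in divisors n by rewrite -dvdn_divisors.
rewrite !(bigD1_seq n nn (divisors_uniq n)) /=.
have -> : \sum_(d <- divisors n | d != n) f d = \sum_(d <- divisors n | d != n) g d.
  rewrite big_seq_cond [RHS]big_seq_cond; apply: eq_bigr => d /andP[].
  rewrite -dvdn_divisors // => dn d_neq; have := dvdn_leq n_gt0 dn => d_le.
  by apply: IHn; [lia | apply: dvdn_gt0 dn].
exact: addIr.
Qed.

(** * Ramanujan sums and their mean over k^2 - 1 *)

Lemma ramanujan_sumE (R : realType) (n : nat) (a : int) :
  ramanujan_sum R n a =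
  \sum_(1 <= j < n.+1 | coprime j n) circle_exp R (j%:R * (a%:~R / n%:R)).
Proof. by apply: eq_bigr => j _; rewrite /circle_exp !mulrA. Qed.

Lemma sum_ramanujan_divisors (R : realType) (n : nat) (a : int) : (0 < n)%N ->
  \sum_(d <- divisors n) ramanujan_sum R d a =
  if (n %| a)%Z then n%:R else 0.
Proof.
move=> n_gt0; rewrite -sum_circle_exp // sum_frac // !big_seq.
apply: eq_bigr => d; rewrite -dvdn_divisors // => /dvdnP[q nE].
rewrite nE in n_gt0 *; rewrite ramanujan_sumE mulnK; last by nia.
apply: eq_bigr => j _; congr circle_exp; rewrite !natrM; field.
by rewrite !pnatr_eq0; apply/andP; split; nia.
Qed.

Lemma ramanujan_sum_periodic (R : realType) (n : nat) (a b : int) :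
  (0 < n)%N -> ramanujan_sum R n (a + b * n%:Z) = ramanujan_sum R n a.
Proof.
move=> n_gt0; rewrite !ramanujan_sumE; apply: eq_bigr => j _.
rewrite intrD intrM mulrDl mulfK ?pnatr_eq0 -?lt0n //.
by rewrite mulrDr circle_expD -[j%:R]/(j%:Z%:~R) -intrM circle_exp_int mulr1.
Qed.

Definition ramanujan_mean (R : realType) (n : nat) : R[i] :=
  n%:R^-1 * \sum_(1 <= k < n.+1) ramanujan_sum R n (k%:Z ^+ 2 - 1).

(** For d dividing n, the mean over one period d is also the mean over 1, ..., n. With this common
    range the sums over d and k can be exchanged, and the inner sum becomes n times the indicator of
    k^2 = 1 modulo n. *)
Lemma sum_ramanujan_mean (R : realType) (n : nat) : (0 < n)%N ->
  \sum_(d <- divisors n) ramanujan_mean R d = (size (unit_roots n))%:R.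
Proof.
move=> n_gt0; have n_neq0 : n%:R != 0 :> R[i] by rewrite pnatr_eq0 -lt0n.
transitivity (\sum_(d <- divisors n) n%:R^-1 *
    \sum_(1 <= k < n.+1) ramanujan_sum R d (k%:Z ^+ 2 - 1)).
  rewrite !big_seq; apply: eq_bigr => d; rewrite -dvdn_divisors // => /dvdnP[q nE].
  have d_gt0 : (0 < d)%N by nia.
  have q_gt0 : (0 < q)%N by nia.
  rewrite nE [(q * d)%N]mulnC sum_periodic => [|k]; last first.
    (* The multiplier comes from (k + d)^2 = k^2 + (2k + d) d. *)
    rewrite -[RHS](ramanujan_sum_periodic _ _ _ (k%:Z *+ 2 + d%:Z)) //.
    by congr ramanujan_sum; rewrite PoszD; ring.
  rewrite natrM -[X in _ * X]mulr_natr /ramanujan_mean; field.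
  by rewrite !pnatr_eq0; apply/andP; split; lia.
rewrite -mulr_sumr exchange_big /=.
under eq_bigr do rewrite sum_ramanujan_divisors //.
have cond k : (n %| (k%:Z ^+ 2 - 1))%Z = (k ^ 2 == 1 %[mod n])%N.
  by rewrite -eqz_mod_dvd -rmorphXn /= !modz_nat.
under eq_bigr do rewrite cond.
apply: (mulfI n_neq0); rewrite mulrA divff // mul1r.
(* [unit_roots] lists residues from 0 to n - 1, so the term at n is traded for the one at 0,
   congruent to it. *)
have -> : \sum_(1 <= k < n.+1) (if (k ^ 2 == 1 %[mod n])%N then n%:R else 0 : R[i])
   = \sum_(0 <= k < n) (if (k ^ 2 == 1 %[mod n])%N then n%:R else 0).
  rewrite -(prednK n_gt0) [LHS]big_nat_recr // [RHS]big_nat_recl //= addrC.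
  rewrite big_add1 /= (prednK n_gt0); congr (_ + _).
  by rewrite -modnXm modnn.
rewrite -big_mkcond /= big_const_seq iter_addr_0 -[LHS]mulr_natr.
by rewrite /unit_roots size_filter /index_iota subn0.
Qed.

Theorem corollary5 (R : realType) (n j m : nat) (n_gt0 : (0 < n)%N)
    (n_eq : n = (2 ^ j * m)%N) (m_odd : odd m) :
  let S : R[i] :=
    n%:R^-1 * \sum_(1 <= k < n.+1) ramanujan_sum R n (k%:Z ^+ 2 - 1) in
  (j \in [:: 0; 2; 3]%N /\ squarefree m -> S = (const_c j)%:R /\ S != 0) /\
  (~ (j \in [:: 0; 2; 3]%N /\ squarefree m) -> S = 0).
Proof.
move=> S; have -> : S = (const_c j * mean_value m)%:R.
  rewrite -[S]/(ramanujan_mean R n).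
  (* The mean and [mean_value] have the same divisor sums, hence agree; multiplicativity then
     separates 2^j from m. *)
  rewrite (@eq_divisor_sums _ _ (fun d => (mean_value d)%:R) _ n n_gt0); last first.
    by move=> d d_gt0; rewrite sum_ramanujan_mean // -natr_sum sum_mean_value.
  rewrite n_eq multiplicative_mean_value.2 ?mean_value_pfactor //.
  - by rewrite expn_gt0.
  - by case: m m_odd {n_eq}.
  - by case: (posnP j) => [->|?]; rewrite ?coprime1n // coprime_pexpl ?coprime2n.
have [sqf nsqf] := mean_value_odd m m_odd.
split=> [[jin /sqf ->]|njs].
  by rewrite muln1 pnatr_eq0; move: jin; rewrite !inE => /or3P[] /eqP ->.
have [sqm|/nsqf->] := pselect (squarefree m); last by rewrite muln0.
(* For j = 1 and j > 3 the default value 0 of [const_c] is the true one; the other j contradict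
   [njs]. *)
by case: j {n_eq} njs => [|[|[|[|j]]]] njs //; case: njs; split.
Qed.
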